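(* Let $A$ be a residually finite group and $E$ a finite normal subgroup in $A$. If $A/E$ is an arithmetic group then $A$ is an arithmetic group.
   Context: A group $G$ is residually finite if for every $g\in G$ with $g\neq 1$ there is a subgroup of finite index in $G$ not containing $g$. A $\mathbb{Q}$-defined linear algebraic group is a subgroup $G\le \mathrm{GL}(n,\mathbb{C})$ ($n\in\mathbb{N}$) which is also an affine algebraic set defined by polynomials with rational coefficients; for a subring $R\le\mathbb{C}$ put $G(R)=G\cap \mathrm{GL}(n,R)$. A subgroup $\Delta\le G(\mathbb{Q})$ is an arithmetic subgroup of $G$ if $\Delta\cap G(\mathbb{Z})$ has finite index in both $\Delta$ and $G(\mathbb{Z})$. An abstract group is called arithmetic if it is isomorphic to an arithmetic subgroup of some $\mathbb{Q}$-defined linear algebraic group. *)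

(* Defs.v *)
From HB Require Import structures.
From mathcomp Require Import all_boot all_order all_algebra.
From mathcomp Require Import generic_quotient.
From mathcomp Require Import boolp classical_sets functions cardinality reals.
From mathcomp Require Import complex mpoly.

Set Implicit Arguments.
Unset Strict Implicit.
Unset Printing Implicit Defensive.

Import GRing.Theory.

Local Open Scope group_scope.
Local Open Scope classical_set_scope.
Local Open Scope quotient_scope.

Section AbstractGroups.
Variable G : groupType.
Implicit Types H K E : {pred G}.

Definition left_coset (x : G) H : set G := [set x * h | h in [set` H]].

(* [H] is meant to be a subgroup of [K]. *)
Definition finite_index H K : Prop :=
  finite_set [set left_coset x H | x in [set` K]].

Definition residually_finite : Prop :=
  forall g : G, g != 1 ->
    exists H : {pred G},
      [/\ group_closed H, finite_index H predT & g \notin H].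

Definition conj_closed E : Prop := forall x y : G, x \in E -> x ^ y \in E.

End AbstractGroups.

Section Quotient.
Variables (G : groupType) (E : {pred G}).
Hypotheses (gE : group_closed E) (nE : conj_closed E).

Definition coset_rel : rel G := fun x y => x^-1 * y \in E.

Fact coset_rel_equiv : equiv_class_of coset_rel.
Proof.
split=> [x | x y | y x z]; rewrite /coset_rel; first by rewrite mulVg gE.1.
  by apply/idP/idP => /(group_closedV gE); rewrite invgM invgK.
by move=> xy yz; have := group_closedM gE xy yz; rewrite mulgA mulgK.
Qed.

Canonical coset_equiv := EquivRelPack coset_rel_equiv.

(* Normality is recorded in the type so that the group structure is canonical. *)
Definition quotient_group & conj_closed E := {eq_quot coset_equiv}.

Local Notation Q := (quotient_group nE).

HB.instance Definition _ := Choice.on Q.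
HB.instance Definition _ := EqQuotient.on Q.

Lemma quotient_eqP (x y : G) : reflect (\pi_Q x = \pi_Q y) (x^-1 * y \in E).
Proof. exact: eqquotP. Qed.

Definition quotient_one : Q := \pi_Q 1.
Definition quotient_inv (u : Q) : Q := \pi_Q (repr u)^-1.
Definition quotient_mul (u v : Q) : Q := \pi_Q (repr u * repr v).

Let repr_piE x : x^-1 * repr (\pi_Q x) \in E.
Proof. by apply/quotient_eqP; rewrite reprK. Qed.

Lemma quotient_mulE x y : quotient_mul (\pi x) (\pi y) = \pi_Q (x * y).
Proof.
apply/esym/quotient_eqP; set x' := repr _; set y' := repr _.
have -> : (x * y)^-1 * (x' * y') = y^-1 * y' * (x^-1 * x') ^ y'.
  by rewrite conjgE invgM !mulgA mulgK.
by apply: (group_closedM gE); last apply: nE; exact: repr_piE.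
Qed.

Lemma quotient_invE x : quotient_inv (\pi x) = \pi_Q x^-1.
Proof.
apply/quotient_eqP; rewrite invgK.
have := @nE _ x^-1 (repr_piE x).
by rewrite conjgE invgK !mulgA mulgV mul1g.
Qed.

Fact quotient_mulA : associative quotient_mul.
Proof.
by move=> u v w; rewrite -[u]reprK -[v]reprK -[w]reprK !quotient_mulE mulgA.
Qed.

Fact quotient_mul1g : left_id quotient_one quotient_mul.
Proof. by move=> u; rewrite -[u]reprK quotient_mulE mul1g. Qed.

Fact quotient_mulVg : left_inverse quotient_one quotient_inv quotient_mul.
Proof. by move=> u; rewrite -[u]reprK quotient_invE quotient_mulE mulVg. Qed.

Fact quotient_mulg1 : right_id quotient_one quotient_mul.
Proof. by move=> u; rewrite -[u]reprK quotient_mulE mulg1. Qed.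

Fact quotient_mulgV : right_inverse quotient_one quotient_inv quotient_mul.
Proof. by move=> u; rewrite -[u]reprK quotient_invE quotient_mulE mulgV. Qed.

HB.instance Definition _ := isGroup.Build Q
  quotient_mulA quotient_mul1g quotient_mulg1 quotient_mulVg quotient_mulgV.

End Quotient.

Section GeneralLinear.
Variables (n : nat) (K : fieldType).

Definition GL := {M : 'M[K]_n | M \in unitmx}.

HB.instance Definition _ := Choice.on GL.

Definition GL_one : GL := exist _ (1%:M)%R (unitmx1 _ _).

Fact GL_inv_subproof (g : GL) : invmx (val g) \in unitmx.
Proof. by rewrite unitmx_inv (valP g). Qed.
Definition GL_inv (g : GL) : GL := exist _ (invmx (val g)) (GL_inv_subproof g).

Fact GL_mul_subproof (g h : GL) : (val g *m val h)%R \in unitmx.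
Proof. by rewrite unitmx_mul (valP g) (valP h). Qed.
Definition GL_mul (g h : GL) : GL :=
  exist _ (val g *m val h)%R (GL_mul_subproof g h).

Fact GL_mulA : associative GL_mul.
Proof. by move=> f g h; apply/val_inj; rewrite /= mulmxA. Qed.
Fact GL_mul1g : left_id GL_one GL_mul.
Proof. by move=> g; apply/val_inj; rewrite /= mul1mx. Qed.
Fact GL_mulg1 : right_id GL_one GL_mul.
Proof. by move=> g; apply/val_inj; rewrite /= mulmx1. Qed.
Fact GL_mulVg : left_inverse GL_one GL_inv GL_mul.
Proof. by move=> g; apply/val_inj; rewrite /= mulVmx ?(valP g). Qed.
Fact GL_mulgV : right_inverse GL_one GL_inv GL_mul.
Proof. by move=> g; apply/val_inj; rewrite /= mulmxV ?(valP g). Qed.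

HB.instance Definition _ :=
  isGroup.Build GL GL_mulA GL_mul1g GL_mulg1 GL_mulVg GL_mulgV.

End GeneralLinear.

Section ArithmeticGroups.
Variable R : realType.
Local Notation C := R[i].

Definition Zring : {pred C} := [pred z | `[< exists m : int, z = m%:~R%R >]].
Definition Qring : {pred C} := [pred z | `[< exists q : rat, z = ratr q >]].

(* [p] has one variable per matrix entry, enumerated as in [mxvec]. *)
Definition eval_mx n (p : {mpoly rat[n * n]}) (M : 'M[C]_n) : C :=
  (map_mpoly ratr p).@[fun k => mxvec M 0%R k].

(* Zero loci are taken inside GL(n, C), i.e. closed subsets of GL(n, C) itself
   and not of the space of all matrices: GL(n, C) is allowed as an example.
   Polynomials in the inverse of the determinant would give the same sets. *)
Definition Q_algebraic_set n (G : {pred GL n C}) : Prop :=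
  exists P : set {mpoly rat[n * n]},
    forall g : GL n C,
      g \in G <-> (forall p, P p -> eval_mx p (val g) = 0%R).

Definition Q_algebraic_group n (G : {pred GL n C}) : Prop :=
  group_closed G /\ Q_algebraic_set G.

(* The inverse must have entries in [S] too: this is membership in GL(n, S). *)
Definition points n (G : {pred GL n C}) (S : {pred C}) : {pred GL n C} :=
  [pred g in G | (val g \is a mxOver S) && (val g^-1 \is a mxOver S)].

Definition arithmetic_subgroup n (G D : {pred GL n C}) : Prop :=
  let GZ := points G Zring in
  let DZ := [predI D & GZ] in
  [/\ group_closed D, {subset D <= points G Qring},
      finite_index DZ D & finite_index DZ GZ].

Definition arithmetic_group (A : groupType) : Prop :=
  exists n (G D : {pred GL n C}),
    [/\ Q_algebraic_group G, arithmetic_subgroup G D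
      & exists f : {multiplicative A -> GL n C}, set_bij [set: A] [set` D] f].

End ArithmeticGroups.

(* Main.v *)
Require Import Defs.
From HB Require Import structures.
From mathcomp Require Import all_boot all_order all_algebra.
From mathcomp Require Import boolp classical_sets cardinality reals.
From mathcomp Require Import complex mpoly generic_quotient.

(** The group [A] embeds, with finite index, in the product of [A / E] and a
    finite group, and arithmeticity passes to such subgroups.

    Residual finiteness provides for every nontrivial [e] in [E] a subgroup of
    finite index that misses [e]; as [E] is finite, the intersection [H] of
    these subgroups still has finite index, and it meets [E] trivially
    ([residually_finite_avoid]). The action of [A] on the finitely many left
    cosets of [H] is a morphism [phi] to permutation matrices whose kernel lies
    in [H] ([finite_index_perm_action]). If [f] is an isomorphism from [A / E]
    to an arithmetic subgroup [D] of [G], then [a |-> diag (f (a E), phi a)] is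
    injective, since its kernel is contained in both [E] and [H].

    The image is arithmetic in the group of all [diag (g, h)] with [g] in [G]
    and [h] a permutation matrix ([arithmetic_group_joint_embedding]). This
    group is defined over [Q] because the permutation matrices are exactly the
    automorphisms of the algebra [C ^ m], a condition given by quadratic
    equations ([perm_matricesP], [Q_algebraic_block_product]). There are
    finitely many permutation matrices and they are all integral, so that
    commensurability of the image with the integral points follows from that
    of [D] with the integral points of [G]. *)

Set Implicit Arguments.
Unset Strict Implicit.
Unset Printing Implicit Defensive.

Import GRing.Theory.

Local Open Scope group_scope.
Local Open Scope classical_set_scope.

(** * Group morphisms and subgroups of finite index *)

Section GroupMorphism.
Variables (G H : groupType) (f : G -> H) (fM : {morph f : x y / x * y}).

Fact group_morph1 : f 1 = 1.
Proof. by apply: (mulgI (f 1)); rewrite -fM !mulg1. Qed.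

(** A multiplicative map between groups preserves the unit; bundling that fact
    gives access to the theory of unitary morphisms, in particular to its lemmas
    on inverses. *)
Definition group_morphism : UMagmaMorphism.type G H :=
  HB.pack f (isUMagmaMorphism.Build G H f (group_morph1, fM)).

End GroupMorphism.

Section FiniteIndex.
Variable G : groupType.
Implicit Types H K : {pred G}.

Lemma left_cosetP H (gH : group_closed H) (x y : G) :
  reflect (left_coset x H = left_coset y H) (x^-1 * y \in H).
Proof.
apply: (iffP idP) => [xyH | eq_xy].
  apply/seteqP; split=> z [h /= hH <-].
    exists ((x^-1 * y)^-1 * h); last by rewrite invgM invgK !mulgA mulgV mul1g.
    exact: group_closedM gH _ _ (group_closedV gH xyH) hH.
  exists (x^-1 * y * h); last by rewrite !mulgA mulgV mul1g.
  exact: group_closedM gH _ _ xyH hH.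
have : left_coset y H y by exists 1; [exact: gH.1 | rewrite mulg1].
rewrite -eq_xy => -[h /= hH <-].
by rewrite mulgA mulVg mul1g.
Qed.

(** Numbering the left cosets of [H] that meet [K]: [c] sends a point to the
    number of its coset and [r] picks representatives. Outside [K] the value of
    [c] is arbitrary. *)
Lemma finite_index_transversal H K :
    group_closed H -> 1 \in K -> finite_index H K ->
  exists m (r : 'I_m -> G) (c : G -> 'I_m),
    [/\ forall i, r i \in K, cancel r c
      & {in K &, forall x y, (c x == c y) = (x^-1 * y \in H)}].
Proof.
move=> gH K1 /finite_seqP[s0 defS]; pose s := undup s0.
have memS X : (X \in s) <-> [set left_coset x H | x in [set` K]] X.
  by rewrite mem_undup defS.
have s_gt0 : (0 < size s)%N.
  have : left_coset 1 H \in s by apply/memS; exists 1.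
  by case: (s).
have r_ex (i : 'I_(size s)) :
    {x : G | x \in K /\ left_coset x H = tnth (in_tuple s) i}.
  by apply: cid; have /memS[x xK <-] := mem_tnth i (in_tuple s); exists x.
pose r i := sval (r_ex i).
pose c x := insubd (Ordinal s_gt0) (index (left_coset x H) s).
have c_idx x : x \in K -> c x = index (left_coset x H) s :> nat.
  by move=> xK; rewrite val_insubd index_mem ifT //; apply/memS; exists x.
exists (size s), r, c; split=> [i | i | x y xK yK].
- by have [] := svalP (r_ex i).
- have [rK ri] := svalP (r_ex i); apply: val_inj; rewrite /= c_idx // ri.
  by rewrite (tnth_nth set0) index_uniq ?undup_uniq.
- have xs : left_coset x H \in s by apply/memS; exists x.
  have ys : left_coset y H \in s by apply/memS; exists y.
  rewrite -val_eqE /= !c_idx //; apply/eqP/(left_cosetP gH) => [eq_i | -> //].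
  by rewrite -(nth_index set0 xs) eq_i nth_index.
Qed.

(** A finite colouring of [K] that separates the left cosets of [H] bounds the
    index. Colours may split cosets, so that indices of intersections, preimages
    and towers are bounded by pairing colours. *)
Lemma finite_index_colouring H K (T : finType) (c : G -> T) :
    group_closed H -> {in K &, forall x y, c x = c y -> x^-1 * y \in H} ->
  finite_index H K.
Proof.
move=> gH cK.
pose r t := xget 1 [set x | x \in K /\ c x = t].
apply: (@sub_finite_set _ _ ((fun t => left_coset (r t) H) @` [set: T])).
  move=> _ [x xK <-]; exists (c x) => //; apply/(left_cosetP gH).
  have [|rK cr] := @xgetPex _ 1 [set y | y \in K /\ c y = c x].
    by exists x.
  exact: cK.
exact/finite_image/finite_finset.
Qed.

Lemma group_closedI H K :
  group_closed H -> group_closed K -> group_closed [predI H & K].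
Proof.
move=> gH gK; split=> [|x y /andP[xH xK] /andP[yH yK]].
  by rewrite inE gH.1 gK.1.
by rewrite inE; apply/andP; split; [apply: gH.2 | apply: gK.2].
Qed.

Lemma finite_indexI H K : group_closed H -> group_closed K ->
  finite_index H predT -> finite_index K predT ->
  finite_index [predI H & K] predT.
Proof.
move=> gH gK.
move=> /(finite_index_transversal gH (isT : 1 \in predT))[m [_ [c [_ _ cP]]]].
move=> /(finite_index_transversal gK (isT : 1 \in predT))[n [_ [d [_ _ dP]]]].
apply: (@finite_index_colouring _ _ _ (fun x => (c x, d x))).
  exact: group_closedI.
move=> x y _ _ [] /eqP cxy /eqP dxy.
by rewrite inE /= -cP // -dP // cxy.
Qed.

(** Intersecting one subgroup of finite index for each point of [X]. *)
Lemma residually_finite_avoid (X : set G) :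
    residually_finite G -> finite_set X -> ~ X 1 ->
  exists H : {pred G},
    [/\ group_closed H, finite_index H predT & forall x, X x -> x \notin H].
Proof.
move=> rfG /finite_seqP[s ->] s1.
have {s1} : 1 \notin s by apply/negP.
elim: s => [|g s IHs].
  exists xpredT; split=> //.
  exact: (@finite_index_colouring _ _ unit (fun=> tt)).
rewrite inE negb_or eq_sym => /andP[/rfG[H [gH fH gNH]] /IHs[K [gK fK sK]]].
exists ([predI H & K] : {pred G}).
split; [exact: group_closedI | exact: finite_indexI |].
move=> x; rewrite /= !inE => /predU1P[-> | /sK]; first by rewrite (negPf gNH).
by rewrite negb_and orbC => ->.
Qed.

End FiniteIndex.

(** * Permutation matrices *)

Section PermutationMatrices.
Variables (m : nat) (F : fieldType).
Local Open Scope ring_scope.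

(** These equations force each entry to be [0] or [1] and each row to have at
    most one nonzero entry, which for an invertible matrix means that it is a
    permutation matrix. Being polynomial with integral coefficients, they define
    this finite group as an algebraic group over the rationals. *)
Definition perm_matrices : {pred GL m F} :=
  [pred g : GL m F | [forall i : 'I_m, forall j : 'I_m, forall k : 'I_m,
     val g i j * val g i k == val g i j *+ (j == k)]].

Lemma perm_matricesE (g : GL m F) :
  reflect (forall i j k, val g i j * val g i k = val g i j *+ (j == k))
          (g \in perm_matrices).
Proof.
apply: (iffP forallP) => [gP i j k | gP i].
  by have /forallP/(_ j)/forallP/(_ k)/eqP := gP i.
by apply/forallP=> j; apply/forallP=> k; apply/eqP.
Qed.

Local Notation "u ∘ v" := (map2_mx *%R u v) (at level 40).

(** The equations say that [g] is compatible with the componentwise product on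
    the basis vectors, hence that it is an algebra automorphism of [F ^ m]. In
    this form stability under products and inverses is immediate. *)
Lemma perm_matricesP (g : GL m F) :
  reflect (forall u v : 'cV_m, (val g *m u) ∘ (val g *m v) = val g *m (u ∘ v))
          (g \in perm_matrices).
Proof.
apply: (iffP (perm_matricesE g)) => [gP u v | gP i j k].
  apply/colP=> i; rewrite !mxE big_distrlr /=; apply: eq_bigr => j _.
  rewrite (bigD1 j) //= mulrACA gP eqxx mxE big1 ?addr0 // => k j'k.
  by rewrite mulrACA gP eq_sym (negPf j'k) mul0r.
have /colP/(_ i) := gP (delta_mx j 0) (delta_mx k 0).
have -> : delta_mx j 0 ∘ delta_mx k 0 = (j == k)%:R *: delta_mx j 0 :> 'cV[F]_m.
  apply/colP=> l; rewrite !mxE !andbT -!natrM !mulnb.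
  by case: (eqVneq l j) => [-> | _]; rewrite /= ?andbT ?andbF.
by rewrite -scalemxAr -!colE !mxE mulr_natl.
Qed.

Lemma perm_matrices_group : group_closed perm_matrices.
Proof.
split=> [|g h /perm_matricesP gP /perm_matricesP hP]; apply/perm_matricesP => u v.
  by rewrite !mul1mx.
have hVP (x y : 'cV_m) : (invmx (val h) *m x) ∘ (invmx (val h) *m y)
             = invmx (val h) *m (x ∘ y).
  by apply: (canRL (mulKmx (valP h))); rewrite -[LHS]hP !(mulKVmx (valP h)).
by rewrite -!mulmxA gP hVP.
Qed.

Lemma perm_matrices_entry (g : GL m F) i j :
  g \in perm_matrices -> val g i j = (val g i j != 0)%:R.
Proof.
move/perm_matricesE/(_ i j j); rewrite eqxx mulr1n => gij.
have [-> //|nz] := eqVneq (val g i j) 0.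
by apply: (mulfI nz); rewrite gij mulr1.
Qed.

(** A permutation matrix is determined by its support, so that there are
    finitely many of them and the support can serve as a colour. *)
Lemma perm_matrices_support (g h : GL m F) :
    g \in perm_matrices -> h \in perm_matrices ->
    [ffun ij => val g ij.1 ij.2 != 0] = [ffun ij => val h ij.1 ij.2 != 0]
      :> {ffun 'I_m * 'I_m -> bool} ->
  g = h.
Proof.
move=> gP hP /ffunP eq_gh; apply/val_inj/matrixP=> i j.
rewrite (perm_matrices_entry i j gP) (perm_matrices_entry i j hP).
by have := eq_gh (i, j); rewrite !ffunE => ->.
Qed.

End PermutationMatrices.

(** The action by left translation on the cosets of [H]; an element acting
    trivially fixes the coset [H] itself and so belongs to [H]. *)
Lemma finite_index_perm_action (F : fieldType) (G : groupType) (H : {pred G}) :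
    group_closed H -> finite_index H predT ->
  exists m (phi : UMagmaMorphism.type G (GL m F)),
    (forall x, phi x \in @perm_matrices m F)
    /\ forall x, phi x = 1 -> x \in H.
Proof.
move=> gH.
move=> /(finite_index_transversal gH (isT : 1 \in predT))[m [r [c [_ rK cE]]]].
have {}cE x y : (c x == c y) = (x^-1 * y \in H) by rewrite cE.
have cM x y : c (x * r (c y)) = c (x * y).
  by apply/eqP; rewrite cE invgM mulgA mulgVK -cE rK.
pose M x : 'M[F]_m := (\matrix_(i, j) (i == c (x * r j)%g)%:R)%R.
have MM x y : M (x * y)%g = (M x *m M y)%R.
  apply/matrixP=> i k; rewrite !mxE (bigD1 (c (y * r k))) //= big1 => [|j nj].
    by rewrite !mxE eqxx cM mulr1 addr0 mulgA.
  by rewrite !mxE (negPf nj) mulr0.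
have M1 : M 1 = (1%:M)%R by apply/matrixP=> i j; rewrite !mxE mul1g rK.
have Mu x : M x \in unitmx.
  have := mulmx1_unit (etrans (esym (MM x x^-1)) _).
  by rewrite mulgV => /(_ M1)[].
pose f x : GL m F := exist _ (M x) (Mu x).
have fM : {morph f : x y / x * y} by move=> x y; apply/val_inj/MM.
exists m, (group_morphism fM); split=> x.
  apply/perm_matricesE=> i j k; rewrite /= !mxE.
  case: (i =P c (x * r j)) => [-> | _]; last by rewrite mul0r mul0rn.
  by rewrite mul1r cE invgM mulgA mulgVK -cE !rK.
(* The diagonal entry at the coset of 1 tells whether x fixes this coset. *)
move/(congr1 val)/matrixP/(_ (c 1) (c 1)).
rewrite /= !mxE eqxx cM mulg1; case: eqP => [/eqP | _ /esym/eqP].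
  by rewrite cE invg1 mul1g.
by rewrite oner_eq0.
Qed.

(** * Block diagonal products of linear groups *)

Section BlockDiagonal.
Variables (n m : nat) (F : fieldType).
Implicit Types (g : GL n F) (h : GL m F).

Fact GL_block_subproof g h :
  (block_mx (val g) 0 0 (val h))%R \in unitmx.
Proof. by rewrite unitmxE det_ublock unitrM -!unitmxE (valP g) (valP h). Qed.

Definition GL_block g h : GL (n + m) F :=
  exist _ (block_mx (val g) 0 0 (val h))%R (GL_block_subproof g h).

Lemma GL_blockM g1 h1 g2 h2 :
  GL_block (g1 * g2) (h1 * h2) = GL_block g1 h1 * GL_block g2 h2.
Proof.
apply/val_inj; rewrite /= (mulmx_block (val g1) 0 0 (val h1))%R.
by rewrite !mul0mx !mulmx0 !addr0 add0r.
Qed.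

Lemma GL_block1 : GL_block 1 1 = 1.
Proof. by apply/val_inj; rewrite /= -scalar_mx_block. Qed.

Lemma GL_blockV g h : GL_block g^-1 h^-1 = (GL_block g h)^-1.
Proof.
by apply: (mulIg (GL_block g h)); rewrite -GL_blockM !mulVg GL_block1.
Qed.

(** The projections of the product onto its factors. The default value [1] only
    matters for matrices that are not block diagonal. *)
Definition GL_ul (x : GL (n + m) F) : GL n F :=
  insubd (1 : GL n F) (ulsubmx (val x)).
Definition GL_dr (x : GL (n + m) F) : GL m F :=
  insubd (1 : GL m F) (drsubmx (val x)).

Lemma GL_blockKl g h : GL_ul (GL_block g h) = g.
Proof.
by apply/val_inj; rewrite val_insubd /= block_mxKul (valP g).
Qed.

Lemma GL_blockKr g h : GL_dr (GL_block g h) = h.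
Proof.
by apply/val_inj; rewrite val_insubd /= block_mxKdr (valP h).
Qed.

Definition block_product (G : {pred GL n F}) (L : {pred GL m F}) :
    {pred GL (n + m) F} :=
  [pred x | `[< exists g h, [/\ g \in G, h \in L & x = GL_block g h] >]].

Lemma block_productP (G : {pred GL n F}) (L : {pred GL m F}) x :
  reflect (exists g h, [/\ g \in G, h \in L & x = GL_block g h])
          (x \in block_product G L).
Proof. exact: asboolP. Qed.

Lemma block_product_group G L :
  group_closed G -> group_closed L -> group_closed (block_product G L).
Proof.
move=> gG gL; split=> [|x y].
  apply/block_productP; exists 1, 1.
  by split; [exact: gG.1 | exact: gL.1 | rewrite GL_block1].
case/block_productP=> [g1 [h1 [g1G h1L ->]]].
case/block_productP=> [g2 [h2 [g2G h2L ->]]].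
apply/block_productP; exists (g1 / g2), (h1 / h2).
by split; [exact: gG.2 | exact: gL.2 | rewrite GL_blockM GL_blockV].
Qed.

End BlockDiagonal.

(** * Zero loci of rational polynomials *)

Section RationalClosedSets.
Variable R : realType.
Local Notation C := R[i].
Local Open Scope ring_scope.

Definition Q_closed n (Z : GL n C -> Prop) : Prop :=
  exists P : set {mpoly rat[n * n]},
    forall g : GL n C, Z g <-> forall p, P p -> eval_mx p (val g) = 0.

Lemma Q_closed_poly n (p : {mpoly rat[n * n]}) (Z : GL n C -> Prop) :
  (forall g, Z g <-> eval_mx p (val g) = 0) -> Q_closed Z.
Proof.
by move=> Zp; exists [set p] => g; rewrite Zp; split=> [? _ -> // | ]; apply.
Qed.

Lemma Q_closed_forall n (I : Type) (Z : I -> GL n C -> Prop) :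
  (forall i, Q_closed (Z i)) -> Q_closed (fun g => forall i, Z i g).
Proof.
move=> /choice[P ZP]; exists (\bigcup_i P i) => g.
split=> [Zg p [i _ Pp] | Pg i].
  exact: (ZP i g).1 (Zg i) p Pp.
by apply/ZP => p Pp; apply: Pg; exists i.
Qed.

Lemma Q_closed_and n (Y Z : GL n C -> Prop) :
  Q_closed Y -> Q_closed Z -> Q_closed (fun g => Y g /\ Z g).
Proof.
move=> [P YP] [Q ZQ]; exists (P `|` Q) => g; rewrite YP ZQ; split.
  by move=> [Pg Qg] p [/Pg | /Qg].
by move=> PQg; split=> p pP; apply: PQg; [left | right].
Qed.

Definition entry_poly n (i j : 'I_n) : {mpoly rat[n * n]} :=
  'X_(mxvec_index i j).

Lemma eval_entry_poly n (i j : 'I_n) (M : 'M[C]_n) :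
  eval_mx (entry_poly i j) M = M i j.
Proof. by rewrite /eval_mx map_mpolyX mevalXU mxvecE. Qed.

Lemma eval_mxB n (p q : {mpoly rat[n * n]}) (M : 'M[C]_n) :
  eval_mx (p - q) M = eval_mx p M - eval_mx q M.
Proof. by rewrite /eval_mx rmorphB mevalB. Qed.

Lemma eval_mxM n (p q : {mpoly rat[n * n]}) (M : 'M[C]_n) :
  eval_mx (p * q) M = eval_mx p M * eval_mx q M.
Proof. by rewrite /eval_mx rmorphM mevalM. Qed.

Lemma eval_mxMn n (p : {mpoly rat[n * n]}) k (M : 'M[C]_n) :
  eval_mx (p *+ k) M = eval_mx p M *+ k.
Proof. by rewrite /eval_mx rmorphMn mevalMn. Qed.

Definition ul_poly n m (p : {mpoly rat[n * n]}) :
    {mpoly rat[(n + m) * (n + m)]} :=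
  p \mPo [tuple mxvec (\matrix_(i < n, j < n)
                         entry_poly (lshift m i) (lshift m j)) 0 k | k < n * n].

Lemma eval_ul_poly n m (p : {mpoly rat[n * n]}) (M : 'M[C]_(n + m)) :
  eval_mx (ul_poly m p) M = eval_mx p (ulsubmx M).
Proof.
rewrite /eval_mx /ul_poly map_mpoly_comp; last exact: fmorph_inj.
rewrite comp_mpoly_meval; apply: meval_eq => k.
rewrite tnth_map tnth_mktuple; case/mxvec_indexP: k => i j.
rewrite !mxvecE !mxE; exact: eval_entry_poly.
Qed.

(** The equations of the product are the vanishing of the off-diagonal blocks,
    those of [G] in the upper left block, and those of the permutation matrices
    in the lower right block. *)
Lemma Q_algebraic_block_product n m (G : {pred GL n C}) :
  Q_algebraic_set G ->
  Q_algebraic_set (block_product G (@perm_matrices m C)).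
Proof.
move=> [P GP].
pose Z (x : GL (n + m) C) :=
  ((forall i j, val x (lshift m i) (rshift n j) = 0) /\
   (forall i j, val x (rshift n i) (lshift m j) = 0)) /\
  ((forall p : {p | P p}, eval_mx (sval p) (ulsubmx (val x)) = 0) /\
   (forall i j k, drsubmx (val x) i j * drsubmx (val x) i k
                  = drsubmx (val x) i j *+ (j == k))).
suff [Q ZQ] : Q_closed Z.
  exists Q => x; rewrite -ZQ; split.
    case/block_productP=> g [h [gG /perm_matricesE hL ->]].
    split; split=> /=.
    - by move=> i j; rewrite block_mxEur mxE.
    - by move=> i j; rewrite block_mxEdl mxE.
    - by move=> p; rewrite block_mxKul; exact: (GP g).1 gG _ (svalP p).
    - by rewrite block_mxKdr.
  move=> [[ur dl] [ulP drP]].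
  (* A block diagonal invertible matrix has invertible diagonal blocks. *)
  have xE : val x = block_mx (ulsubmx (val x)) 0 0 (drsubmx (val x)).
    rewrite -[LHS]submxK; congr block_mx; apply/matrixP=> i j; rewrite !mxE.
      exact: ur.
    exact: dl.
  have := valP x; rewrite {1}xE unitmxE det_ublock unitrM -!unitmxE.
  case/andP=> ulU drU; pose g : GL n C := exist _ (ulsubmx (val x)) ulU.
  pose h : GL m C := exist _ (drsubmx (val x)) drU.
  apply/block_productP; exists g, h; split; last exact/val_inj.
    by apply/GP=> p Pp; apply: (ulP (exist _ p Pp)).
  exact/perm_matricesE.
apply: Q_closed_and; apply: Q_closed_and.
- apply: Q_closed_forall => i; apply: Q_closed_forall => j.
  apply: (@Q_closed_poly _ (entry_poly (lshift m i) (rshift n j))) => x.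
  by rewrite eval_entry_poly.
- apply: Q_closed_forall => i; apply: Q_closed_forall => j.
  apply: (@Q_closed_poly _ (entry_poly (rshift n i) (lshift m j))) => x.
  by rewrite eval_entry_poly.
- apply: Q_closed_forall => p.
  by apply: (@Q_closed_poly _ (ul_poly m (sval p))) => x; rewrite eval_ul_poly.
- apply: Q_closed_forall => i; apply: Q_closed_forall => j.
  apply: Q_closed_forall => k.
  pose q j : {mpoly rat[(n + m) * (n + m)]} :=
    entry_poly (rshift n i) (rshift n j).
  apply: (@Q_closed_poly _ (q j * q k - q j *+ (j == k))) => x.
  rewrite eval_mxB eval_mxMn eval_mxM !eval_entry_poly !mxE.
  by split=> [-> | /eqP]; rewrite ?subrr // subr_eq0 => /eqP.
Qed.

End RationalClosedSets.

(** * Points over a subring *)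

Section Points.
Variable R : realType.
Local Notation C := R[i].

Lemma ZringP (z : C) : reflect (exists k : int, z = (k%:~R)%R) (z \in @Zring R).
Proof. exact: asboolP. Qed.

Lemma QringP (z : C) : reflect (exists q : rat, z = ratr q) (z \in @Qring R).
Proof. exact: asboolP. Qed.

Local Open Scope ring_scope.

Lemma Zring_subring : subring_closed (@Zring R).
Proof.
split=> [|_ _ /ZringP[k ->] /ZringP[l ->]|_ _ /ZringP[k ->] /ZringP[l ->]].
- by apply/ZringP; exists 1.
- by apply/ZringP; exists (k - l); rewrite intrB.
- by apply/ZringP; exists (k * l); rewrite intrM.
Qed.

Lemma Qring_subring : subring_closed (@Qring R).
Proof.
split=> [|_ _ /QringP[k ->] /QringP[l ->]|_ _ /QringP[k ->] /QringP[l ->]].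
- by apply/QringP; exists 1; rewrite rmorph1.
- by apply/QringP; exists (k - l); rewrite rmorphB.
- by apply/QringP; exists (k * l); rewrite rmorphM.
Qed.

Section Subring.
Variables (S : {pred C}) (Sring : subring_closed S).

Lemma subring_add x y : x \in S -> y \in S -> x + y \in S.
Proof.
have [S1 SB _] := Sring; have S0 : 0 \in S by rewrite -(subrr 1) SB.
by move=> xS yS; rewrite -[y]opprK -[- y]sub0r !SB.
Qed.

Lemma subring_nat k : k%:R \in S.
Proof.
have [S1 SB _] := Sring.
elim: k => [|k IHk]; first by rewrite mulr0n -(subrr 1) SB.
by rewrite -natr1 subring_add.
Qed.

Lemma mxOver_mulmx m n p (M : 'M[C]_(m, n)) (N : 'M[C]_(n, p)) :
  M \is a mxOver S -> N \is a mxOver S -> M *m N \is a mxOver S.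
Proof.
have [S1 SB SM] := Sring => /mxOverP MS /mxOverP NS; apply/mxOverP=> i k.
rewrite mxE; apply: (big_ind (fun z => z \in S)) => [|x y|j _].
- exact: (subring_nat 0).
- exact: subring_add.
- exact: SM.
Qed.

Lemma points_group n (G : {pred GL n C}) :
  group_closed G -> group_closed (points G S).
Proof.
move=> gG; split=> [|x y /and3P[xG xS xVS] /and3P[yG yS yVS]].
  have oneS : val (1 : GL n C)%g \is a mxOver S.
    by apply/mxOverP=> i j; rewrite mxE; apply: subring_nat.
  by apply/and3P; rewrite invg1; split=> //; exact: gG.1.
apply/and3P; rewrite invgM invgK; split; first exact: gG.2.
  exact: (mxOver_mulmx xS yVS).
exact: (mxOver_mulmx yS xVS).
Qed.

Lemma block_mx_over n m (g : GL n C) (h : GL m C) :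
  (val (GL_block g h) \is a mxOver S)
    = (val g \is a mxOver S) && (val h \is a mxOver S).
Proof.
apply/mxOverP/andP=> [ghS | [/mxOverP gS /mxOverP hS] i j].
  split; apply/mxOverP=> i j.
    by have := ghS (lshift m i) (lshift m j); rewrite block_mxEul.
  by have := ghS (rshift n i) (rshift n j); rewrite block_mxEdr.
rewrite /= -(fintype.splitK i) -(fintype.splitK j).
case: (fintype.split i) => i'; case: (fintype.split j) => j' /=.
- by rewrite block_mxEul.
- by rewrite block_mxEur mxE; apply: (subring_nat 0).
- by rewrite block_mxEdl mxE; apply: (subring_nat 0).
- by rewrite block_mxEdr.
Qed.

Lemma perm_matrices_points m (h : GL m C) :
  h \in @perm_matrices m C -> h \in points (@perm_matrices m C) S.
Proof.
have aux k : k \in @perm_matrices m C -> val k \is a mxOver S.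
  move=> kP; apply/mxOverP=> i j; rewrite (perm_matrices_entry i j kP).
  exact: subring_nat.
move=> hP; have hVP := group_closedV (perm_matrices_group _ _) hP.
by apply/and3P; split; [exact: hP | exact: aux hP | exact: aux hVP].
Qed.

(** Permutation matrices and their inverses have entries [0] and [1], so the
    second factor imposes no condition. *)
Lemma block_points n m (G : {pred GL n C}) (g : GL n C) (h : GL m C) :
    h \in @perm_matrices m C ->
  (GL_block g h \in points (block_product G (@perm_matrices m C)) S)
    = (g \in points G S).
Proof.
move=> hP; have /and3P[_ hS hVS] := perm_matrices_points hP.
rewrite 2!inE -!GL_blockV !block_mx_over hS hVS !andbT; congr andb.
apply/block_productP/idP => [[g' [h' [g'G _]]] | gG].
  by move/(congr1 (@GL_ul _ _ _)); rewrite !GL_blockKl => ->.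
by exists g, h.
Qed.

End Subring.
End Points.

(** * Arithmetic groups *)

(** Two colourings do the work. On the image [D'] of [A], the coset of [f a]
    modulo the integral points suffices. On the integral points
    [diag (g, h)] of the product, if [g] and [g'] lie in the same coset with
    representative [r], then [g = r * f a] and [g' = r * f b] for some [a] and
    [b]; recording the permutation [phi a] as well as [h] ensures that
    [diag (g, h)] and [diag (g', h')] of the same colour differ by the image of
    [a^-1 * b], which lies in the kernel of [phi]. *)
Lemma arithmetic_group_joint_embedding (R : realType) (A : groupType) n m
    (G D : {pred GL n R[i]}) (f : UMagmaMorphism.type A (GL n R[i]))
    (phi : UMagmaMorphism.type A (GL m R[i])) :
    Q_algebraic_group G -> arithmetic_subgroup G D ->
    (forall g, g \in D <-> exists a, f a = g) ->
    (forall a, phi a \in @perm_matrices m R[i]) ->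
    (forall a, f a = 1 -> phi a = 1 -> a = 1) ->
  arithmetic_group R A.
Proof.
move=> [gG algG] [gD DQ fiD fiG] fD phiP f_phi_inj.
pose L := @perm_matrices m R[i].
pose F a := GL_block (f a) (phi a).
have FM : {morph F : a b / a * b} by move=> a b; rewrite /F !gmulfM GL_blockM.
pose FF := group_morphism FM.
have F_inj : injective FF.
  apply: gmulf_inj => a /= Fa1; apply: f_phi_inj.
    rewrite -(GL_blockKl (f a) (phi a)) [GL_block _ _]Fa1.
    by rewrite -GL_block1 GL_blockKl.
  rewrite -(GL_blockKr (f a) (phi a)) [GL_block _ _]Fa1.
  by rewrite -GL_block1 GL_blockKr.
pose G' := block_product G L.
pose D' : {pred GL (n + m) R[i]} := [pred x | `[< exists a, F a = x >]].
have D'P x : reflect (exists a, F a = x) (x \in D') by exact: asboolP.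
have Df a : f a \in D by apply/fD; exists a.
have gD' : group_closed D'.
  split=> [|_ _ /D'P[a <-] /D'P[b <-]]; apply/D'P.
    by exists 1; apply: (group_morph1 FM).
  by exists (a / b); apply: (gmulfF FF).
have gG' : group_closed G'.
  by apply: block_product_group => //; exact: perm_matrices_group.
pose GZ := points G (@Zring R); pose GZ' := points G' (@Zring R).
have gGZ : group_closed GZ by exact: points_group (@Zring_subring R) _ _ gG.
have gDZ : group_closed [predI D & GZ] by exact: group_closedI.
have gDZ' : group_closed [predI D' & GZ'].
  by apply: group_closedI => //; exact: points_group (@Zring_subring R) _ _ gG'.
have FZ a : (F a \in [predI D' & GZ']) = (f a \in GZ).
  rewrite inE /= (_ : F a \in D') ?andTb; last by apply/D'P; exists a.
  exact: block_points (@Zring_subring R) _ _ _ _ _ (phiP a).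
exists (n + m)%N, G', D'; split.
- by split=> //; exact: Q_algebraic_block_product.
- split=> //.
  + move=> _ /D'P[a <-].
    by rewrite (block_points (@Qring_subring R) _ _ (phiP a)); apply: DQ.
  + have [q [r [c [_ _ cP]]]] := finite_index_transversal gDZ gD.1 fiD.
    apply: (@finite_index_colouring _ _ _ _ (fun x => c (GL_ul x))) => //.
    move=> _ _ /D'P[a <-] /D'P[b <-]; rewrite !GL_blockKl => /eqP.
    rewrite cP // -!(gmulfV, gmulfM) => /andP[_ abZ].
    by rewrite -(gmulfV FF) -FM FZ.
  + have [q [r [c [rGZ rK cP]]]] := finite_index_transversal gDZ gGZ.1 fiG.
    have lift x : {a | x \in GZ -> f a = (r (c x))^-1 * x}.
      apply: cid; case xGZ: (x \in GZ); last by exists 1.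
      have := cP _ _ (rGZ (c x)) xGZ.
      rewrite rK eqxx => /esym/andP[/fD[a fa] _]; by exists a.
    pose s (h : GL m R[i]) : {ffun 'I_m * 'I_m -> bool} :=
      [ffun ij => val h ij.1 ij.2 != 0%R].
    pose colour x :=
      (c (GL_ul x), s (phi (sval (lift (GL_ul x)))), s (GL_dr x)).
    have colourE g h :
        colour (GL_block g h) = (c g, s (phi (sval (lift g))), s h).
      by rewrite /colour GL_blockKl GL_blockKr.
    apply: (@finite_index_colouring _ _ _ _ colour gDZ') => x y xG yG.
    move: (xG) (yG).
    case/andP: xG => /block_productP[g [h [_ hL ->]]] _.
    case/andP: yG => /block_productP[g' [h' [_ h'L ->]]] _.
    rewrite (block_points (@Zring_subring R) _ _ hL).
    rewrite (block_points (@Zring_subring R) _ _ h'L) !colourE => gZ g'Z /eqP.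
    rewrite !xpair_eqE => /andP[/andP[/eqP cgg' /eqP sab] /eqP shh'].
    move: sab; case: (lift g) => a /= /(_ gZ) fa.
    case: (lift g') => b /= /(_ g'Z) fb sab.
    have phiab := perm_matrices_support (phiP a) (phiP b) sab.
    rewrite (perm_matrices_support hL h'L shh').
    have -> : (GL_block g h')^-1 * GL_block g' h' = F (a^-1 * b).
      rewrite -GL_blockV -GL_blockM mulVg /F !gmulfM !gmulfV.
      by rewrite phiab mulVg fa fb cgg' invgM invgK mulgA mulgK.
    rewrite FZ !gmulfM !gmulfV fa fb cgg' invgM invgK mulgA mulgK.
    exact: group_closedM gGZ _ _ (group_closedV gGZ gZ) g'Z.
- exists FF; split=> [a _|a b _ _|x /= xD'].
  + by apply/D'P; exists a.
  + exact: F_inj.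
  + by have /D'P[a <-] := xD'; exists a.
Qed.

Theorem proposition1p8 (R : realType) (A : groupType) (E : {pred A})
    (gE : group_closed E) (nE : conj_closed E) :
  residually_finite A ->
  finite_set [set` E]%classic ->
  arithmetic_group R (quotient_group gE nE) ->
  arithmetic_group R A.
Proof.
move=> rfA finE [n [G [D [algG arD [f [fD f_inj f_surj]]]]]].
have [||H [gH fiH HE]] := @residually_finite_avoid A ([set` E] `\ 1) rfA.
- exact: finite_setD.
- by move=> [_]; apply.
have [m [phi [phiP phiH]]] := finite_index_perm_action R[i] gH fiH.
pose p (a : A) : quotient_group gE nE := \pi_(quotient_group gE nE)%qT a.
have fpM : {morph f \o p : a b / a * b}.
  by move=> a b; rewrite /= -gmulfM; congr (f _); apply/esym/quotient_mulE.
apply: (arithmetic_group_joint_embedding (f := group_morphism fpM) algG arD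
          _ phiP).
- move=> g; split=> [gD | [a <-]]; last exact: fD.
  have [u _ <-] := f_surj g gD; exists (repr u).
  by rewrite /= /p reprK.
- (* The kernel of f \o p is E, and phi a = 1 puts a in H. *)
  move=> a fa1 phia1; apply/eqP; apply: contraT => a_neq1.
  suff: a \notin H by rewrite phiH.
  apply: HE; split; last exact/eqP.
  have : p 1 = p a.
    by apply: f_inj; rewrite ?inE // -[LHS]/((f \o p) 1) (group_morph1 fpM).
  by move/quotient_eqP; rewrite invg1 mul1g.
Qed.
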